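(* Let $G$ be a subgroup of the permutation group $\mathcal{S}_3$. Then any $G$-Hom-coalgebra $(V,\Delta,\beta)$ over $\mathbb{K}$ is a Hom-Lie admissible Hom-coalgebra.
   Context: $\mathbb{K}$ is an algebraically closed field of characteristic $0$. A Hom-coalgebra is a triple $(V,\Delta,\beta)$ where $V$ is a $\mathbb{K}$-vector space and $\Delta:V\to V\otimes V$, $\beta:V\to V$ are linear maps (no coassociativity or Hom-coassociativity is assumed). $\Delta^{op}=\tau\circ\Delta$, where $\tau(x\otimes y)=y\otimes x$. For a linear map $D:V\to V\otimes V$, the $\beta$-coassociator is $\mathbf{c}_\beta(D)=(D\otimes\beta)\circ D-(\beta\otimes D)\circ D$. For $\sigma$ in the symmetric group $\mathcal{S}_3$, $\Phi_\sigma:V^{\otimes 3}\to V^{\otimes 3}$ is the linear map $\Phi_\sigma(x_1\otimes x_2\otimes x_3)=x_{\sigma^{-1}(1)}\otimes x_{\sigma^{-1}(2)}\otimes x_{\sigma^{-1}(3)}$, and $(-1)^{\epsilon(\sigma)}$ is the signature of $\sigma$. For a subgroup $G$ of $\mathcal{S}_3$, a Hom-coalgebra $(V,\Delta,\beta)$ is a $G$-Hom-coalgebra if $\sum_{\sigma\in G}(-1)^{\epsilon(\sigma)}\Phi_\sigma\circ\mathbf{c}_\beta(\Delta)=0$. A Hom-coalgebra $(V,\Delta,\beta)$ is a Hom-Lie admissible Hom-coalgebra if $\Delta_L:=\Delta-\Delta^{op}$ satisfies $\mathbf{c}_\beta(\Delta_L)+\Phi_{(213)}\circ\mathbf{c}_\beta(\Delta_L)+\Phi_{(231)}\circ\mathbf{c}_\beta(\Delta_L)=0$,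 where $(213)$ and $(231)$ are (in cycle notation) the two cyclic permutations of order 3 in $\mathcal{S}_3$. *)

(* Defs.v *)
From HB Require Import structures.
From mathcomp Require Import all_boot all_order all_algebra all_fingroup.
From mathcomp Require Import generic_quotient ring_quotient sesquilinear.
From mathcomp Require Import boolp.
From mathcomp Require Import freeg.

Set Implicit Arguments.
Unset Strict Implicit.
Unset Printing Implicit Defensive.

Import GRing.Theory.
Local Open Scope ring_scope.
Local Open Scope quotient_scope.

Section FreegExtra.
Variables (R : fieldType) (T : choiceType).

Lemma freegUZ (a : R) (x : T) : << a *g x >> = a *: << x >>.
Proof. by apply/eqP/freeg_eqP => y; rewrite coeffZ !coeffU mul1r. Qed.

Variables (W : lmodType R) (f : T -> W).

HB.instance Definition _ :=
  GRing.isZmodMorphism.Build {freeg T / R} W (fglift f) (lift_is_additive f).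

Lemma fglift_is_scalable : scalable (fglift f).
Proof.
move=> a x.
have Ex : fglift f x = \sum_(y <- dom x) coeff y x *: f y.
  by rewrite -[in LHS](freeg_sumE x) raddf_sum; apply: eq_bigr => y _; exact: liftU.
rewrite Ex -[in LHS](freeg_sumE x) scaler_sumr raddf_sum scaler_sumr /=.
by apply: eq_bigr => y _; rewrite freegUZ scalerA -freegUZ !liftU scalerA.
Qed.

HB.instance Definition _ :=
  GRing.isScalable.Build R {freeg T / R} W _ (fglift f) fglift_is_scalable.

End FreegExtra.

(* [tensor U V] is the free K-module on the set U * V modulo the submodule
   [tensor_null] generated by the bilinearity relations.                      *)
Section TensorProduct.
Variables (K : fieldType) (U V : lmodType K).

Inductive tensor_null : {freeg (U * V)%type / K} -> Prop :=
| null_addl u u' v :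
    tensor_null (<< (u + u', v) >> - << (u, v) >> - << (u', v) >>)
| null_addr u v v' :
    tensor_null (<< (u, v + v') >> - << (u, v) >> - << (u, v') >>)
| null_scalel a u v : tensor_null (<< (a *: u, v) >> - a *: << (u, v) >>)
| null_scaler a u v : tensor_null (<< (u, a *: v) >> - a *: << (u, v) >>)
| null_zero : tensor_null 0
| null_lin a x y : tensor_null x -> tensor_null y -> tensor_null (a *: x + y).

Definition tensor_nullb : {pred {freeg (U * V)%type / K}} :=
  fun x => `[< tensor_null x >].

Lemma tensor_nullbP x : reflect (tensor_null x) (x \in tensor_nullb).
Proof. exact: asboolP. Qed.

Lemma tensor_nullb_zmod_closed : zmod_closed tensor_nullb.
Proof.
split; first by apply/tensor_nullbP; exact: null_zero.
move=> x y /tensor_nullbP xN /tensor_nullbP yN; apply/tensor_nullbP.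
by rewrite addrC -scaleN1r; exact: null_lin.
Qed.

HB.instance Definition _ :=
  GRing.isZmodClosed.Build {freeg (U * V)%type / K} tensor_nullb
    tensor_nullb_zmod_closed.

Lemma tensor_nullbZ a x : x \in tensor_nullb -> a *: x \in tensor_nullb.
Proof.
move=> /tensor_nullbP xN; apply/tensor_nullbP; rewrite -[_ *: _]addr0.
by apply: null_lin => //; exact: null_zero.
Qed.

(* The wrapper only keeps unification from unfolding the quotient. *)
Record tensor := Tensor { tensor_class : Quotient.quot tensor_nullb }.

HB.instance Definition _ := [isNew for tensor_class].
HB.instance Definition _ := [Choice of tensor by <:].

Definition tensor_zero := Tensor 0.
Definition tensor_opp s := Tensor (- tensor_class s).
Definition tensor_add s t := Tensor (tensor_class s + tensor_class t).

Lemma tensor_addA : associative tensor_add.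
Proof. by move=> r s t; rewrite /tensor_add /= addrA. Qed.

Lemma tensor_addC : commutative tensor_add.
Proof. by move=> s t; rewrite /tensor_add addrC. Qed.

Lemma tensor_add0 : left_id tensor_zero tensor_add.
Proof. by case=> t; rewrite /tensor_add add0r. Qed.

Lemma tensor_addN : left_inverse tensor_zero tensor_opp tensor_add.
Proof. by move=> t; rewrite /tensor_add addNr. Qed.

HB.instance Definition _ := GRing.isZmodule.Build tensor
  tensor_addA tensor_addC tensor_add0 tensor_addN.

Definition tensor_pi (x : {freeg (U * V)%type / K}) : tensor := Tensor (\pi x).

Definition tensor_repr (t : tensor) : {freeg (U * V)%type / K} :=
  repr (tensor_class t).

Lemma tensor_piK t : tensor_pi (tensor_repr t) = t.
Proof. by case: t => t; rewrite /tensor_pi reprK. Qed.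

Lemma tensor_piP x y : reflect (tensor_pi x = tensor_pi y)
  (x - y \in tensor_nullb).
Proof.
rewrite Quotient.idealrBE; apply: (iffP eqP) => [xy|[] //].
by rewrite /tensor_pi xy.
Qed.

Lemma tensor_piD x y : tensor_pi (x + y) = tensor_pi x + tensor_pi y.
Proof. by rewrite /tensor_pi; congr Tensor; rewrite piE. Qed.

Definition tensor_scale a (t : tensor) : tensor := tensor_pi (a *: tensor_repr t).

Lemma tensor_scale_pi a x : tensor_scale a (tensor_pi x) = tensor_pi (a *: x).
Proof.
apply/tensor_piP; rewrite -scalerBr tensor_nullbZ //.
by apply/tensor_piP; rewrite tensor_piK.
Qed.

Lemma tensor_scaleA a b t :
  tensor_scale a (tensor_scale b t) = tensor_scale (a * b) t.
Proof. by rewrite -[t]tensor_piK !tensor_scale_pi scalerA. Qed.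

Lemma tensor_scale1 : left_id 1 tensor_scale.
Proof. by move=> t; rewrite -[t]tensor_piK tensor_scale_pi scale1r. Qed.

Lemma tensor_scaleDr : right_distributive tensor_scale +%R.
Proof.
move=> a s t; rewrite -[s]tensor_piK -[t]tensor_piK.
by rewrite -tensor_piD !tensor_scale_pi -tensor_piD scalerDr.
Qed.

Lemma tensor_scaleDl t : {morph tensor_scale^~ t : a b / a + b}.
Proof.
by move=> a b; rewrite -[t]tensor_piK !tensor_scale_pi -tensor_piD scalerDl.
Qed.

HB.instance Definition _ := GRing.Zmodule_isLmodule.Build K tensor
  tensor_scaleA tensor_scale1 tensor_scaleDr tensor_scaleDl.

Lemma tensor_pi_is_linear : linear tensor_pi.
Proof. by move=> a x y; rewrite tensor_piD -tensor_scale_pi. Qed.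

HB.instance Definition _ := GRing.isLinear.Build K _ _ _ tensor_pi
  tensor_pi_is_linear.

Definition tens (u : U) (v : V) : tensor := tensor_pi << (u, v) >>.

Lemma tens_is_bilinear : bilinear_for *:%R *:%R tens.
Proof.
split=> [v a u u'|u a v v'].
- have -> : tens (a *: u + u') v = tens (a *: u) v + tens u' v.
    rewrite /tens -linearD /=; apply/tensor_piP; apply/tensor_nullbP.
    by rewrite opprD addrA; exact: null_addl.
  congr (_ + _); rewrite /tens -linearZ /=; apply/tensor_piP/tensor_nullbP.
  exact: null_scalel.
- have -> : tens u (a *: v + v') = tens u (a *: v) + tens u v'.
    rewrite /tens -linearD /=; apply/tensor_piP; apply/tensor_nullbP.
    by rewrite opprD addrA; exact: null_addr.
  congr (_ + _); rewrite /tens -linearZ /=; apply/tensor_piP/tensor_nullbP.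
  exact: null_scaler.
Qed.

HB.instance Definition _ :=
  bilinear_isBilinear.Build K U V tensor *:%R *:%R tens tens_is_bilinear.

Lemma tensor_ind (P : tensor -> Prop) :
  (forall u v, P (tens u v)) -> P 0 ->
  (forall a s t, P s -> P t -> P (a *: s + t)) -> forall t, P t.
Proof.
move=> Ptens P0 Plin t; rewrite -[t]tensor_piK -[tensor_repr t]freeg_sumE linear_sum /=.
elim/big_ind: _ => // [s s' Ps Ps'|[u v] _].
  by rewrite -[s]scale1r; exact: Plin.
rewrite freegUZ linearZ /= -[_ *: _]addr0; apply: Plin => //; exact: Ptens.
Qed.

Lemma tensor_linear_ext (W : lmodType K) (f g : {linear tensor -> W}) :
  (forall u v, f (tens u v) = g (tens u v)) -> f =1 g.
Proof.
move=> fg; apply: tensor_ind => [u v||a s t fgs fgt]; rewrite ?linear0 //.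
by rewrite !linearP fgs fgt.
Qed.

End TensorProduct.

Section Lift.
Variables (K : fieldType) (U V W : lmodType K).
Variable f : {bilinear U -> V -> W}.

Let F (p : U * V) : W := f p.1 p.2.

Definition tlift (t : tensor U V) : W := fglift F (tensor_repr t).

Let F_null x : tensor_null x -> fglift F x = 0.
Proof.
elim=> [u u' v|u v v'|a u v|a u v||a y z _ Fy _ Fz]; last 2 first.
- by rewrite linear0.
- by rewrite linearP /= Fy Fz scaler0 addr0.
all: rewrite !raddfB /= ?linearZ /= !liftU !scale1r /F /=.
- by rewrite linearDl addrAC addrK subrr.
- by rewrite linearDr addrAC addrK subrr.
- by rewrite linearZl_LR scalerN subrr.
- by rewrite linearZ_LR scalerN subrr.
Qed.

Let tlift_pi x : tlift (tensor_pi x) = fglift F x.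
Proof.
apply/eqP; rewrite -subr_eq0 -raddfB /=; apply/eqP/F_null/tensor_nullbP.
by apply/tensor_piP; rewrite tensor_piK.
Qed.

Lemma tlift_is_linear : linear tlift.
Proof.
move=> a s t; rewrite -[s]tensor_piK -[t]tensor_piK -linearP !tlift_pi.
exact: linearP.
Qed.

HB.instance Definition _ := GRing.isLinear.Build K _ _ _ tlift tlift_is_linear.

Lemma tliftE u v : tlift (tens u v) = f u v.
Proof. by rewrite tlift_pi liftU scale1r. Qed.

End Lift.

Section TensorMap.
Variables (K : fieldType) (U V U' V' : lmodType K).
Variables (f : {linear U -> U'}) (g : {linear V -> V'}).

Definition tmap_fun u v : tensor U' V' := tens (f u) (g v).

Lemma tmap_fun_is_bilinear : bilinear_for *:%R *:%R tmap_fun.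
Proof.
by split=> [v a u u'|u a v v']; rewrite /tmap_fun linearP ?linearPl ?linearPr.
Qed.

HB.instance Definition _ := bilinear_isBilinear.Build K U V (tensor U' V')
  *:%R *:%R tmap_fun tmap_fun_is_bilinear.

Definition tmap : tensor U V -> tensor U' V' := tlift tmap_fun.

Lemma tmap_is_linear : linear tmap.
Proof. exact: tlift_is_linear. Qed.

HB.instance Definition _ := GRing.isLinear.Build K (tensor U V) (tensor U' V')
  *:%R tmap tmap_is_linear.

Lemma tmapE u v : tmap (tens u v) = tens (f u) (g v).
Proof. exact: tliftE. Qed.

End TensorMap.

Section TensorSwap.
Variables (K : fieldType) (U V : lmodType K).

Definition tswap_fun (u : U) (v : V) : tensor V U := tens v u.

Lemma tswap_fun_is_bilinear : bilinear_for *:%R *:%R tswap_fun.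
Proof.
by split=> [v a u u'|u a v v']; rewrite /tswap_fun ?linearPl ?linearPr.
Qed.

HB.instance Definition _ := bilinear_isBilinear.Build K U V (tensor V U)
  *:%R *:%R tswap_fun tswap_fun_is_bilinear.

Definition tswap : tensor U V -> tensor V U := tlift tswap_fun.

Lemma tswap_is_linear : linear tswap.
Proof. exact: tlift_is_linear. Qed.

HB.instance Definition _ := GRing.isLinear.Build K (tensor U V) (tensor V U)
  *:%R tswap tswap_is_linear.

Lemma tswapE u v : tswap (tens u v) = tens v u.
Proof. exact: tliftE. Qed.

End TensorSwap.

Arguments tswap {K U V}.

Section TensorAssoc.
Variables (K : fieldType) (U V W : lmodType K).

Section Inner.
Variable u : U.

Definition tassoc_in v w : tensor (tensor U V) W := tens (tens u v) w.

Lemma tassoc_in_is_bilinear : bilinear_for *:%R *:%R tassoc_in.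
Proof.
by split=> [w a v v'|v a w w']; rewrite /tassoc_in ?linearPl ?linearPr ?linearPl.
Qed.

HB.instance Definition _ := bilinear_isBilinear.Build K V W
  (tensor (tensor U V) W) *:%R *:%R tassoc_in tassoc_in_is_bilinear.

End Inner.

Definition tassoc_fun u t : tensor (tensor U V) W := tlift (tassoc_in u) t.

Lemma tassoc_fun_is_bilinear : bilinear_for *:%R *:%R tassoc_fun.
Proof.
split=> [t a u u'|u a t t']; last exact: linearP.
rewrite /tassoc_fun; elim/tensor_ind: t => [v w||b s t IHs IHt].
- by rewrite !tliftE /= /tassoc_in !linearPl.
- by rewrite /= !linear0 addr0.
- rewrite /= !linearP; move: IHs IHt => /= -> ->; rewrite !scalerDr !scalerA mulrC -!addrA; congr (_ + _).
  by rewrite addrCA.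
Qed.

HB.instance Definition _ := bilinear_isBilinear.Build K U (tensor V W)
  (tensor (tensor U V) W) *:%R *:%R tassoc_fun tassoc_fun_is_bilinear.

Definition tassoc : tensor U (tensor V W) -> tensor (tensor U V) W :=
  tlift tassoc_fun.

Lemma tassoc_is_linear : linear tassoc.
Proof. exact: tlift_is_linear. Qed.

HB.instance Definition _ := GRing.isLinear.Build K (tensor U (tensor V W)) (tensor (tensor U V) W)
  *:%R tassoc tassoc_is_linear.

Lemma tassocE u v w : tassoc (tens u (tens v w)) = tens (tens u v) w.
Proof. by rewrite [LHS]tliftE [LHS]tliftE. Qed.

End TensorAssoc.

Arguments tassoc {K U V W}.

Section Permutation.
Variables (K : fieldType) (V : lmodType K).

Local Notation tensor3 := (tensor (tensor V V) V).

Definition tens3 (x : 'I_3 -> V) : tensor3 :=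
  tens (tens (x 0) (x 1)) (x 2%:R).

Definition triple (x y z : V) (i : 'I_3) : V := nth 0 [:: x; y; z] i.

Lemma ord3P (j : 'I_3) : [\/ j = 0, j = 1 | j = 2%:R].
Proof.
case: j => [[|[|[|//]]] lej];
  [constructor 1 | constructor 2 | constructor 3]; exact: val_inj.
Qed.

Lemma tens3_linear (j : 'I_3) a (x y z : 'I_3 -> V) :
    x j = a *: y j + z j -> (forall i, i != j -> x i = y i /\ x i = z i) ->
  tens3 x = a *: tens3 y + tens3 z.
Proof.
rewrite /tens3; have [->|->|->] := ord3P j => -> xE.
- have [<- <-] := xE 1 isT; have [<- <-] := xE 2%:R isT.
  by rewrite !linearPl.
- have [<- <-] := xE 0 isT; have [<- <-] := xE 2%:R isT.
  by rewrite linearPr linearPl.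
- have [<- <-] := xE 0 isT; have [<- <-] := xE 1 isT.
  by rewrite linearPr.
Qed.

Variable s : 'S_3.

Definition Phi_fun z x y : tensor3 :=
  tens3 (fun i => triple x y z ((s^-1)%g i)).

Let Phi_fun_linear (j : 'I_3) a (x y z : 'I_3 -> V) :
    x j = a *: y j + z j -> (forall i, i != j -> x i = y i /\ x i = z i) ->
  tens3 (x \o (s^-1)%g) = a *: tens3 (y \o (s^-1)%g) + tens3 (z \o (s^-1)%g).
Proof.
move=> xj xE; apply: (@tens3_linear (s j)) => [|i /= i_neq].
  by rewrite /= permK.
by apply: xE; apply: contra_neq i_neq => <-; rewrite permKV.
Qed.

Lemma Phi_fun_is_bilinear z : bilinear_for *:%R *:%R (Phi_fun z).
Proof.
split=> [y a x x'|x a y y'].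
- by apply: (@Phi_fun_linear 0) => // i; have [->|->|->] := ord3P i.
- by apply: (@Phi_fun_linear 1) => // i; have [->|->|->] := ord3P i.
Qed.

HB.instance Definition _ z := bilinear_isBilinear.Build K V V tensor3
  *:%R *:%R (Phi_fun z) (Phi_fun_is_bilinear z).

Definition Phi_tens t z : tensor3 := tlift (Phi_fun z) t.

Lemma Phi_tens_is_bilinear : bilinear_for *:%R *:%R Phi_tens.
Proof.
split=> [z a t t'|t a z z']; first exact: linearP.
rewrite /Phi_tens; elim/tensor_ind: t => [x y||b t t' IHt IHt'].
- rewrite !tliftE /=.
  by apply: (@Phi_fun_linear 2%:R) => // i; have [->|->|->] := ord3P i.
- by rewrite /= !linear0 addr0.
- rewrite /= !linearP; move: IHt IHt' => /= -> ->; rewrite !scalerDr !scalerA mulrC -!addrA; congr (_ + _).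
  by rewrite addrCA.
Qed.

HB.instance Definition _ := bilinear_isBilinear.Build K (tensor V V) V tensor3
  *:%R *:%R Phi_tens Phi_tens_is_bilinear.

Definition Phi : tensor3 -> tensor3 := tlift Phi_tens.

Lemma Phi_is_linear : linear Phi.
Proof. exact: tlift_is_linear. Qed.

HB.instance Definition _ := GRing.isLinear.Build K tensor3 tensor3
  *:%R Phi Phi_is_linear.

Lemma PhiE (x : 'I_3 -> V) : Phi (tens3 x) = tens3 (fun i => x ((s^-1)%g i)).
Proof.
rewrite [LHS]tliftE [LHS]tliftE; congr tens3; apply: funext => i.
by have [->|->|->] := ord3P ((s^-1)%g i).
Qed.

End Permutation.

Arguments Phi {K V} s.

Record Hom_coalgebra (K : fieldType) := HomCoalgebra {
  hc_space :> lmodType K;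
  hc_comul : {linear hc_space -> tensor hc_space hc_space};
  hc_twist : {linear hc_space -> hc_space}
}.

Section HomCoalgebraDefs.
Variables (K : fieldType) (V : lmodType K).
Implicit Type D : {linear V -> tensor V V}.

Definition comul_op D : V -> tensor V V := tswap \o D.

Lemma comul_op_is_linear D : linear (comul_op D).
Proof. by move=> a u v; rewrite /comul_op /= !linearP. Qed.

HB.instance Definition _ D := GRing.isLinear.Build K V (tensor V V) *:%R
  (comul_op D) (comul_op_is_linear D).

Lemma comul_opE D v : comul_op D v = tswap (D v).
Proof. by []. Qed.

Definition comul_L D : V -> tensor V V := D \- comul_op D.

Lemma comul_LE D v : comul_L D v = D v - comul_op D v.
Proof. by []. Qed.

Lemma comul_L_is_linear D : linear (comul_L D).
Proof.
move=> a u v; rewrite !comul_LE linearP comul_op_is_linear.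
by rewrite scalerBr opprD addrACA.
Qed.

HB.instance Definition _ D := GRing.isLinear.Build K V (tensor V V) *:%R
  (comul_L D) (comul_L_is_linear D).

(* The third tensor power of V is realised as tensor (tensor V V) V, hence the
   reassociation of the second term.                                         *)
Definition coassociator (beta : {linear V -> V}) D (v : V) :
    tensor (tensor V V) V :=
  tmap D beta (D v) - tassoc (tmap beta D (D v)).

End HomCoalgebraDefs.

(* The 3-cycles 1 -> 3 -> 2 -> 1, i.e. (213), and 1 -> 2 -> 3 -> 1, i.e. (231),
   written on 'I_3 = {0, 1, 2}.                                               *)
Definition perm213 : 'S_3 := perm (can_inj (@ord_predK 3)).
Definition perm231 : 'S_3 := perm (can_inj (@ordSK 3)).

Definition is_G_Hom_coalgebra (K : fieldType) (G : {group 'S_3})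
    (A : Hom_coalgebra K) : Prop :=
  forall v : A,
    \sum_(s in G) (-1) ^+ odd_perm s *:
      Phi s (coassociator (hc_twist A) (hc_comul A) v) = 0.

Definition Hom_Lie_admissible (K : fieldType) (A : Hom_coalgebra K) : Prop :=
  let c := coassociator (hc_twist A) (comul_L (hc_comul A)) in
  forall v : A,
    c v + Phi perm213 (c v) + Phi perm231 (c v) = 0.

(* Main.v *)
From HB Require Import structures.
Require Import Defs.
From mathcomp Require Import all_boot all_order all_algebra all_fingroup.
From mathcomp Require Import alt.

Set Implicit Arguments.
Unset Printing Implicit Defensive.

Import GRing.Theory.
Local Open Scope ring_scope.

(** Write [t = Delta v], [a = (Delta (x) beta) t] and [b = (beta (x) Delta) t],
    so that the coassociator of Delta at v is [a - b].  Replacing a factor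
    Delta by Delta^op applies a transposition to the third tensor power, and
    replacing [t] by its flip exchanges a and b up to a 3-cycle.  Hence the
    coassociator of [Delta - Delta^op] at v is a combination of four terms
    [x - Phi r x] with r a transposition: x is a, or a rotated by a 3-cycle,
    with sign plus, and b, or b rotated, with sign minus
    ([coassociator_comul_L]).

    The sum of [x - Phi r x] over the three rotations is the alternating sum of
    x over the whole of S_3 ([cyclic_sum_sub_odd]), and rotating x does not
    change that sum.  So the left-hand side of the Hom-Lie identity is twice
    the alternating sum over S_3 of [a - b]
    ([cyclic_sum_coassociator_comul_L]).

    Alternating over S_3 what is already alternated over G multiplies the
    alternating sum over S_3 by the order of G ([alternation_signed_sum]).  For
    a G-Hom-coalgebra that product is 0, and the order of G is invertible in
    characteristic 0. *)

(** * The action of S_3 on the third tensor power *)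

Section Action.
Variables (K : fieldType) (V : lmodType K).
Local Notation V3 := (tensor (tensor V V) V).
Implicit Types (x : V3) (s r : 'S_3).

Lemma tens3_triple (u v w : V) : tens3 (triple u v w) = tens (tens u v) w.
Proof. by []. Qed.

Lemma tensor3_linear_ext (W : lmodType K) (f g : {linear V3 -> W}) :
  (forall u v w, f (tens (tens u v) w) = g (tens (tens u v) w)) -> f =1 g.
Proof.
move=> fg; apply: tensor_linear_ext => t w.
elim/tensor_ind: t => [u v||a t t' IHt IHt'] //; first by rewrite !linear0l !linear0.
by rewrite !linearPl !linearP IHt IHt'.
Qed.

(** The order of the factors is reversed because the product of permutations
    composes from left to right. *)
Lemma PhiM s r x : Phi s (Phi r x) = Phi (r * s)%g x.
Proof.
move: x; apply: (@tensor3_linear_ext _ (Phi s \o Phi r) (Phi (r * s)%g)) => u v w /=.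
rewrite -tens3_triple !PhiE; congr tens3; apply: boolp.funext => i.
by rewrite invMg permM.
Qed.

Lemma Phi1 x : Phi 1%g x = x.
Proof.
move: x; apply: (@tensor3_linear_ext _ (Phi 1%g) idfun) => u v w /=.
rewrite -tens3_triple PhiE; congr tens3; apply: boolp.funext => i.
by rewrite invg1 perm1.
Qed.

Definition signed_sum (A : {set 'S_3}) x : V3 :=
  \sum_(s in A) (-1) ^+ odd_perm s *: Phi s x.

Local Notation alternation := (signed_sum [set: 'S_3]).

Lemma signed_sum_is_linear A : linear (signed_sum A).
Proof.
move=> a x y; rewrite /signed_sum scaler_sumr -big_split; apply: eq_bigr => s _ /=.
by rewrite linearP scalerDr !scalerA mulrC.
Qed.

HB.instance Definition _ A := GRing.isLinear.Build K V3 V3 *:%R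
  (signed_sum A) (signed_sum_is_linear A).

(** Multiplication by r permutes the group and changes all signs by that of r. *)
Lemma alternation_Phi r x :
  alternation (Phi r x) = (-1) ^+ odd_perm r *: alternation x.
Proof.
rewrite /signed_sum scaler_sumr [RHS](reindex_inj (mulgI r)) /=.
apply: eq_big => [s|s _]; first by rewrite !inE.
by rewrite PhiM odd_permM signr_addb scalerA signrMK.
Qed.

(** Each of the #|A| terms of the inner sum contributes the alternating sum of
    x, because its sign cancels the one in [alternation_Phi]. *)
Lemma alternation_signed_sum (A : {set 'S_3}) x :
  alternation (signed_sum A x) = #|A|%:R *: alternation x.
Proof.
rewrite {2}/signed_sum linear_sum scaler_nat -sumr_const; apply: eq_bigr => r _.
by rewrite linearZ /= alternation_Phi scalerA -signr_addb addbb scale1r.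
Qed.

(** * Cyclic sums *)

Definition cyclic_sum x : V3 := x + Phi perm213 x + Phi perm231 x.

Lemma cyclic_sum_is_linear : linear cyclic_sum.
Proof.
move=> a x y; rewrite /cyclic_sum !linearP !scalerDr.
by rewrite [RHS]addrACA; congr (_ + _); rewrite addrACA.
Qed.

HB.instance Definition _ := GRing.isLinear.Build K V3 V3 *:%R
  cyclic_sum cyclic_sum_is_linear.

Lemma perm213_sqr : (perm213 * perm213)%g = perm231.
Proof. by apply/permP => i; rewrite permM !permE; apply/val_inj; case: i => [[|[|[|]]]]. Qed.

Lemma perm213V : (perm213^-1)%g = perm231.
Proof.
apply: (mulgI perm213); rewrite mulgV; apply/permP => i.
by rewrite permM !permE; apply/val_inj; case: i => [[|[|[|]]]].
Qed.

Lemma odd_perm231 : odd_perm perm231 = false.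
Proof. by rewrite -perm213_sqr odd_permM addbb. Qed.

Lemma odd_perm213 : odd_perm perm213 = false.
Proof. by rewrite -odd_permV perm213V odd_perm231. Qed.

(** The 3-cycles are even, and the alternating group has 3!/2 elements. *)
Lemma perm_eq_Alt3 : perm_eq [:: 1%g; perm213; perm231] (enum ('Alt_'I_3)%g).
Proof.
have uniq3 : uniq [:: 1%g; perm213; perm231].
  by apply: (@map_uniq _ _ (fun s : 'S_3 => val (s ord0))); rewrite /= perm1 !permE.
apply: uniq_perm; rewrite ?enum_uniq //.
have card3 : #|('Alt_'I_3)%g| = 3%N.
  by apply/eqP; rewrite -(eqn_pmul2l (isT : 0 < 2)%N) card_Alt card_ord.
apply: (uniq_min_size uniq3 _ _).2; last by rewrite -cardE card3.
move=> s; rewrite mem_enum Alt_even !inE.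
by case/or3P=> /eqP ->; rewrite ?odd_perm1 ?odd_perm213 ?odd_perm231.
Qed.

Lemma cyclic_sumE x : cyclic_sum x = \sum_(s in ('Alt_'I_3)%g) Phi s x.
Proof.
rewrite -big_enum -(perm_big _ perm_eq_Alt3) /= !big_cons big_nil addr0 addrA.
by rewrite Phi1.
Qed.

(** Multiplication by an odd permutation exchanges the even and the odd
    permutations, so the subtracted terms are the odd part of the alternating
    sum. *)
Lemma cyclic_sum_sub_odd r x : odd_perm r ->
  cyclic_sum (x - Phi r x) = alternation x.
Proof.
move=> r_odd; rewrite cyclic_sumE.
under eq_bigr do rewrite linearB /= PhiM.
rewrite sumrB /signed_sum [RHS](bigID (@odd_perm 'I_3)) /= [RHS]addrC -sumrN; congr (_ + _).
  apply: eq_big => [s|s]; first by rewrite Alt_even inE.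
  by rewrite Alt_even => /negPf ->; rewrite scale1r.
rewrite [RHS](reindex_inj (mulgI r)); apply: eq_big => [s|s] /=.
  by rewrite Alt_even inE odd_permM r_odd.
by rewrite Alt_even => /negPf s_even; rewrite odd_permM r_odd s_even expr1 scaleN1r.
Qed.

End Action.

Local Notation alternation := (signed_sum [set: 'S_3]).

(** * The coassociator of [D - D^op] *)

Section Coassociator.
Variables (K : fieldType) (V : lmodType K).
Variables (beta : {linear V -> V}) (D : {linear V -> tensor V V}).

Local Notation t01 := (tperm (0 : 'I_3) 1).
Local Notation t12 := (tperm (1 : 'I_3) 2%:R).

Lemma tens_swap_left t (z : V) : tens (tswap t) z = Phi t01 (tens t z).
Proof.
elim/tensor_ind: t => [x y||a t t' IHt IHt'].
- rewrite tswapE -!tens3_triple PhiE tpermV.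
  by rewrite /tens3 tpermL tpermR tpermD.
- by rewrite !(linear0, linear0l).
- by rewrite !linearP !linearPl linearP /= IHt IHt'.
Qed.

Lemma tassoc_swap_right (z : V) t :
  tassoc (tens z (tswap t)) = Phi t12 (tassoc (tens z t)).
Proof.
elim/tensor_ind: t => [x y||a t t' IHt IHt'].
- rewrite tswapE !tassocE -!tens3_triple PhiE tpermV.
  by rewrite /tens3 tpermL tpermR tpermD.
- by rewrite !(linear0, linear0r).
- by rewrite !linearP !linearPr !linearP /= IHt IHt'.
Qed.

(** The vector z moves from the first factor to the last, which rotates
    [z (x) t] by the 3-cycle [perm213]. *)
Lemma tens_cycle (z : V) t : tens t z = Phi perm213 (tassoc (tens z t)).
Proof.
elim/tensor_ind: t => [x y||a t t' IHt IHt'].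
- rewrite tassocE -!tens3_triple PhiE perm213V.
  by rewrite /tens3 !permE.
- by rewrite !(linear0, linear0r, linear0l).
- by rewrite linearPl !linearPr !linearP /= IHt IHt'.
Qed.

Lemma tassoc_cycle (z : V) t : tassoc (tens z t) = Phi perm231 (tens t z).
Proof. by rewrite tens_cycle PhiM -perm213V mulgV Phi1. Qed.

Lemma tmap_comul_L_left t :
  tmap (comul_L D) beta t = tmap D beta t - Phi t01 (tmap D beta t).
Proof.
apply: (@tensor_linear_ext _ _ _ _ (tmap (comul_L D) beta)
  (tmap D beta \- (Phi t01 \o tmap D beta))) => u v /=.
by rewrite !tmapE /= comul_LE comul_opE linearBl /= tens_swap_left.
Qed.

Lemma tmap_comul_L_right t :
  tassoc (tmap beta (comul_L D) t) =
  tassoc (tmap beta D t) - Phi t12 (tassoc (tmap beta D t)).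
Proof.
apply: (@tensor_linear_ext _ _ _ _ (tassoc \o tmap beta (comul_L D))
  ((tassoc \o tmap beta D) \- (Phi t12 \o (tassoc \o tmap beta D)))) => u v /=.
by rewrite !tmapE /= comul_LE comul_opE linearBr linearB /= tassoc_swap_right.
Qed.

Lemma tmap_swap_left t :
  tmap D beta (tswap t) = Phi perm213 (tassoc (tmap beta D t)).
Proof.
apply: (@tensor_linear_ext _ _ _ _ (tmap D beta \o tswap)
  (Phi perm213 \o (tassoc \o tmap beta D))) => u v /=.
by rewrite tswapE !tmapE tens_cycle.
Qed.

Lemma tmap_swap_right t :
  tassoc (tmap beta D (tswap t)) = Phi perm231 (tmap D beta t).
Proof.
apply: (@tensor_linear_ext _ _ _ _ ((tassoc \o tmap beta D) \o tswap)
  (Phi perm231 \o tmap D beta)) => u v /=.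
by rewrite tswapE !tmapE tassoc_cycle.
Qed.

(** Here a' and b' come from the flipped part of [comul_L D], and each
    subtracted image under a transposition comes from the flipped part of the
    second application of [comul_L D]. *)
Lemma coassociator_comul_L v :
  let a := tmap D beta (D v) in let b := tassoc (tmap beta D (D v)) in
  let a' := Phi perm231 a in let b' := Phi perm213 b in
  coassociator beta (comul_L D) v =
    (a - Phi t01 a) - (b' - Phi t01 b') - ((b - Phi t12 b) - (a' - Phi t12 a')).
Proof.
move=> a b a' b'; rewrite /coassociator /= comul_LE comul_opE.
rewrite (linearB (tmap (comul_L D) beta)) (linearB (tmap beta (comul_L D))) linearB /=.
by rewrite !tmap_comul_L_left !tmap_comul_L_right tmap_swap_left tmap_swap_right.
Qed.

(** Each of the four differences has a cyclic sum equal to the alternating sum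
    of a or of b, since 3-cycles are even: a counts twice, b minus twice. *)
Lemma cyclic_sum_coassociator_comul_L v :
  cyclic_sum (coassociator beta (comul_L D) v) =
  alternation (coassociator beta D v) *+ 2.
Proof.
rewrite coassociator_comul_L linearB [X in X - _]linearB [X in _ - X]linearB /=.
rewrite !cyclic_sum_sub_odd ?odd_tperm //.
rewrite !alternation_Phi odd_perm213 odd_perm231 !scale1r.
by rewrite opprB -mulr2n -linearB.
Qed.

End Coassociator.

Theorem proposition2p8 (K : closedFieldType) (K_char0 : [pchar K] =i pred0)
    (G : {group 'S_3}) (A : Hom_coalgebra K) :
  is_G_Hom_coalgebra G A -> Hom_Lie_admissible A.
Proof.
move=> AG c v.
suff altc0 : alternation (coassociator (hc_twist A) (hc_comul A) v) = 0.
  by have := cyclic_sum_coassociator_comul_L (hc_twist A) (hc_comul A) v;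
    rewrite altc0 mul0rn.
have Gsum0 : signed_sum G (coassociator (hc_twist A) (hc_comul A) v) = 0 by exact: AG.
have /esym/eqP := alternation_signed_sum G (coassociator (hc_twist A) (hc_comul A) v).
rewrite Gsum0 linear0 scaler_eq0 (pcharf0P K).1 //.
by rewrite eqn0Ngt cardG_gt0 => /eqP.
Qed.
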